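(* Let $d\geq 2$, and let $\mathcal{F}$ be a finite nonempty family of subsets of $\mathbb{R}^d$. Suppose that every member of $\mathcal{F}$ is the disjoint union of exactly two nonempty closed convex sets, and that, for each $k$ with $2\leq k\leq d+1$, the intersection of every $k$ (distinct) members of $\mathcal{F}$ is also the disjoint union of exactly two nonempty closed convex sets. Then the intersection of all members of $\mathcal{F}$ has exactly two nonempty closed convex components. In particular, it is nonempty.
   Context: A subset $F\subseteq\mathbb{R}^d$ has ''exactly two nonempty closed convex components'' if it has exactly two connected components and both of them are nonempty closed convex sets. *)

(* Defs.v *)
From HB Require Import structures.
From mathcomp Require Import all_boot all_order all_algebra.
From mathcomp Require Import all_classical all_reals all_analysis.

Set Implicit Arguments.
Unset Strict Implicit.
Unset Printing Implicit Defensive.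

Import Order.TTheory GRing.Theory Num.Theory.
Import numFieldNormedType.Exports.

Local Open Scope classical_set_scope.
Local Open Scope card_scope.
Local Open Scope ring_scope.

(* R^d is 'rV[R]_d with the library's (sup-norm, i.e. product) topology. *)

Definition nonempty_closed_convex (R : realType) (d : nat)
    (A : set 'rV[R]_d) : Prop :=
  [/\ A !=set0, closed A & convex_set (M := 'rV[R]_d) A].

Definition disjoint_union_of_two_convex (R : realType) (d : nat)
    (X : set 'rV[R]_d) : Prop :=
  exists A B : set 'rV[R]_d,
    [/\ nonempty_closed_convex A, nonempty_closed_convex B,
        A `&` B = set0 & X = A `|` B].

Definition components (T : topologicalType) (X : set T) : set (set T) :=
  [set connected_component X x | x in X].

Definition two_convex_components (R : realType) (d : nat)
    (X : set 'rV[R]_d) : Prop :=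
  components X #= `I_2 /\
  (forall C, components X C -> nonempty_closed_convex C).

(* Main.v *)
Require Import Defs.
From HB Require Import structures.
From mathcomp Require Import all_boot all_order all_algebra finmap.
From mathcomp Require Import all_classical all_reals all_analysis.
From mathcomp Require Import ring.
Import Order.TTheory GRing.Theory Num.Theory.
Import numFieldNormedType.Exports.
Local Open Scope classical_set_scope.
Local Open Scope card_scope.
Local Open Scope ring_scope.

Set Implicit Arguments.
Unset Strict Implicit.
Unset Printing Implicit Defensive.

(** Write each member as [X_i = A_i `|` B_i], and say that [i] dominates [j] if
[X_j] meets both [A_i] and [B_i]. Since [X_i `&` X_j] has exactly two convex
components, domination is total (otherwise [X_i `&` X_j] would be convex), and,
because triple intersections also have two components (this is where [2 <= d]
matters), it is transitive. Let [m] be a maximal member. Then [X_j `&` A_m] is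
convex, so it lies in a single part [p_j] of [X_j], and likewise [X_j `&` B_m]
lies in a part [q_j]. Comparing with a maximal member of the subfamily shows
that any [d + 1] of the [p_j] meet, so by Helly's theorem all the [p_j] meet,
and so do all the [q_j]; the whole intersection is the disjoint union of
the intersection of the [p_j] and that of the [q_j]. *)

(** * Convex sets and convex combinations *)

Lemma convex_setP (R : realType) (V : lmodType R) (A : set V) :
  convex_set (M := V) A <->
  forall (t : R) (x y : V), 0 <= t <= 1 -> A x -> A y ->
    A (t *: x + (1 - t) *: y).
Proof.
split=> [cA t x y /andP[t0 t1] Ax Ay|cA x y t].
  have := cA x y (Itv01 t0 t1); rewrite !inE; exact.
rewrite !inE => Ax Ay; by apply: cA => //; apply/andP; split.
Qed.

Lemma convex_set_bigcap (R : realType) (V : lmodType R) (I : Type)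
    (D : set I) (A : I -> set V) :
  (forall i, D i -> convex_set (M := V) (A i)) ->
  convex_set (M := V) (\bigcap_(i in D) A i).
Proof.
move=> cA; apply/convex_setP => t x y t01 Ax Ay i Di.
by move/convex_setP : (cA i Di); apply => //; [exact: Ax | exact: Ay].
Qed.

Lemma convex_setI (R : realType) (V : lmodType R) (A B : set V) :
  convex_set (M := V) A -> convex_set (M := V) B ->
  convex_set (M := V) (A `&` B).
Proof.
move=> /convex_setP cA /convex_setP cB; apply/convex_setP.
by move=> t x y t01 [Ax Bx] [Ay By]; split; [exact: cA | exact: cB].
Qed.

Lemma convex_set_sum (R : realType) (V : lmodType R) (I : eqType)
    (A : set V) (r : seq I) (w : I -> R) (x : I -> V) :
  convex_set (M := V) A ->
  (forall i, i \in r -> 0 <= w i) -> (forall i, i \in r -> A (x i)) ->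
  0 < \sum_(i <- r) w i ->
  A ((\sum_(i <- r) w i)^-1 *: \sum_(i <- r) w i *: x i).
Proof.
move=> /convex_setP cA; elim: r => [|i r IH] w0 Ax; first by rewrite big_nil ltxx.
have wi0 : 0 <= w i by apply: w0; rewrite mem_head.
have Axi : A (x i) by apply: Ax; rewrite mem_head.
have rs j : j \in r -> j \in i :: r by rewrite inE => ->; rewrite orbT.
have {}IH := IH (fun j jr => w0 j (rs j jr)) (fun j jr => Ax j (rs j jr)).
have sr0 : 0 <= \sum_(j <- r) w j.
  by rewrite big_seq; apply: sumr_ge0 => j /rs /w0.
rewrite !big_cons; set s := \sum_(j <- r) w j in IH sr0 *.
(* The induction hypothesis needs a positive total on the tail. If that total is 0, every tail
   weight vanishes and only [x i] remains. *)
move: sr0; rewrite le_eqVlt => /predU1P[s0|s0] ws0.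
  have -> : \sum_(j <- r) w j *: x j = 0.
    rewrite big_seq big1 // => j jr.
    have wj0 : w j = 0.
      move/esym/eqP : s0; rewrite /s big_seq psumr_eq0; last first.
        by move=> k /rs /w0.
      by move/allP => /(_ j jr); rewrite jr => /eqP.
    by rewrite wj0 scale0r.
  move: ws0; rewrite -s0 !addr0 => ws0.
  by rewrite scalerA mulVf ?scale1r // gt_eqF.
have -> : (w i + s)^-1 *: (w i *: x i + \sum_(j <- r) w j *: x j) =
   (w i / (w i + s)) *: x i + (1 - w i / (w i + s)) *: (s^-1 *: \sum_(j <- r) w j *: x j).
  rewrite scalerDr !scalerA mulrC; congr (_ + _ *: _).
  by field; rewrite gt_eqF //= gt_eqF.
apply: cA => //; last exact: IH.
apply/andP; split; first by rewrite divr_ge0 // ltW.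
by rewrite ler_pdivrMr // mul1r lerDl ltW.
Qed.

(** * Affine dependence and Helly's theorem *)

(** Prefixing each point with a coordinate 1 gives more than [d.+1] rows of length [d.+1], hence a
    nonzero [u] in the left kernel. Its entries sum to 0, so they cannot all be nonpositive. *)
Lemma affine_dependence (R : realType) (d n : nat) (x : 'I_n -> 'rV[R]_d) :
  (d.+1 < n)%N -> exists u : 'I_n -> R,
    [/\ \sum_i u i = 0, \sum_i u i *: x i = 0 & exists i, 0 < u i].
Proof.
move=> dn; pose A := row_mx (const_mx 1 : 'cV[R]_n) (\matrix_i x i).
have /rowV0Pn[u /sub_kermxP uA u0] : kermx A != 0.
  rewrite kermx_eq0 -row_leq_rank -ltnNge (leq_ltn_trans (rank_leq_col _)) //.
move: uA; rewrite mul_mx_row -row_mx0 => /eq_row_mx[u1 ux].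
have su : \sum_i u 0 i = 0.
  move/rowP : u1 => /(_ 0); rewrite !mxE => u1; rewrite -[RHS]u1.
  by apply: eq_bigr => i _; rewrite mxE mulr1.
exists (u 0); split => //.
  by rewrite mulmx_sum_row in ux; rewrite -[RHS]ux; apply: eq_bigr => i _; rewrite rowK.
apply: contrapT => npos; move/negP : u0; apply; apply/eqP/rowP => i; rewrite mxE.
have ule i' : u 0 i' <= 0 by rewrite leNgt; apply/negP => ?; apply: npos; exists i'.
have /eqP : \sum_i - u 0 i = 0 by rewrite sumrN su oppr0.
rewrite psumr_eq0 => [/allP /(_ i)|j _]; last by rewrite oppr_ge0.
by rewrite mem_index_enum oppr_eq0 => /(_ isT) /eqP.
Qed.

(* Choose [y j] in every member of [J] except perhaps the [j]-th: the Radon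
   point of the [y j] is then common to all members of [J]. *)
Theorem helly (R : realType) (d : nat) (T : finType) (C : T -> set 'rV[R]_d) :
  (forall j, convex_set (M := 'rV[R]_d) (C j)) ->
  (forall J : {set T}, (#|J| <= d.+1)%N -> (\bigcap_(j in [set` J]) C j) !=set0) ->
  (\bigcap_j C j) !=set0.
Proof.
move=> cC HC; suff /(_ [set: T]%SET) [x Cx] :
    forall J : {set T}, (\bigcap_(j in [set` J]) C j) !=set0.
  by exists x => j _; apply: Cx; rewrite /= inE.
move=> J; have [n] := ubnP #|J|; elim: n J => // n IH J Jn.
have [/HC//|dJ] := leqP #|J| d.+1.
have /choice[y Cy] (j : 'I_#|J|) : exists y,
    forall k : 'I_#|J|, k != j -> C (enum_val k) y.
  have [|y Cy] := IH (J :\ enum_val j)%SET.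
    by move: Jn; rewrite (cardsD1 (enum_val j)) enum_valP ltnS.
  exists y => k kj; apply: Cy; rewrite /= !inE enum_valP andbT.
  by apply: contra kj => /eqP /enum_val_inj ->.
have [u [su sux [i0 ui0]]] := affine_dependence y dJ.
pose s := \sum_(i | 0 < u i) u i.
have s0 : 0 < s.
  by rewrite /s (bigD1 i0) //= ltr_pwDl // sumr_ge0 // => i /andP[/ltW].
have sN : \sum_(i | ~~ (0 < u i)) - u i = s.
  move/eqP : su; rewrite (bigID (fun i => 0 < u i)) /= addrC addr_eq0 sumrN.
  by move=> /eqP ->; rewrite opprK.
have sxN : \sum_(i | ~~ (0 < u i)) - u i *: y i = \sum_(i | 0 < u i) u i *: y i.
  under eq_bigr do rewrite scaleNr.
  move/eqP : sux; rewrite (bigID (fun i => 0 < u i)) /= addrC addr_eq0 sumrN.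
  by move=> /eqP ->; rewrite opprK.
(* If [P] excludes [k], every [y i] with [P i] lies in the [k]-th member, and so does their weighted
   mean. *)
have comb (P : pred 'I_#|J|) (w : 'I_#|J| -> R) k : ~~ P k ->
    (forall i, P i -> 0 <= w i) -> \sum_(i | P i) w i = s ->
    C (enum_val k) (s^-1 *: \sum_(i | P i) w i *: y i).
  move=> Pk w0 ws; rewrite -ws -big_filter -[\sum_(i | P i) _ *: _]big_filter.
  apply: (convex_set_sum (cC (enum_val k))).
  - by move=> i; rewrite mem_filter => /andP[/w0].
  - move=> i; rewrite mem_filter => /andP[Pi _]; apply: Cy.
    by apply: contraNneq Pk => ->.
  - by rewrite big_filter ws.
exists (s^-1 *: \sum_(i | 0 < u i) u i *: y i) => j /= Jj.
rewrite -(enum_rankK_in Jj Jj); set k := enum_rank_in _ _.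
(* The Radon point has two expressions, over positive and over nonpositive coefficients; the one
   that omits [k] is used. *)
have [uk|uk] := boolP (0 < u k); last by apply: comb => // i /ltW.
rewrite -sxN; apply: comb => //; first by rewrite negbK.
by move=> i; rewrite -leNgt oppr_ge0.
Qed.

(** * Connectedness and disjoint unions of two closed convex sets *)

Lemma closed_disjoint_separated (T : topologicalType) (A B : set T) :
  closed A -> closed B -> A `&` B = set0 -> separated A B.
Proof.
by move=> /closure_id cA /closure_id cB AB; split; rewrite -?cA -?cB.
Qed.

(** A separation of [A] would separate the segment joining a point of each piece, which is the
    continuous image of an interval. *)
Lemma convex_connected (R : realType) (V : normedModType R) (A : set V) :
  convex_set (M := V) A -> connected A.
Proof.
move=> /convex_setP cA; apply/connectedP => E [E0 AE sE].
have [[x Ex] [y Ey]] := (E0 false, E0 true).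
pose f (t : R) := t *: x + (1 - t) *: y.
have cf : continuous f.
  move=> t; apply: cvgD; apply: cvgZr_tmp; first exact: cvg_id.
  by apply: cvgB; [exact: cvg_cst | exact: cvg_id].
have fA : f @` `[0, 1] `<=` E false `|` E true.
  rewrite -AE => _ [t /= t01 <-]; apply: cA; first by rewrite in_itv in t01.
  - by rewrite AE; left.
  - by rewrite AE; right.
have f0 : (f @` `[0, 1]) y.
  by exists 0; [rewrite /= in_itv /= lexx ler01 | rewrite /f scale0r add0r subr0 scale1r].
have f1 : (f @` `[0, 1]) x.
  by exists 1; [rewrite /= in_itv /= lexx ler01 | rewrite /f subrr scale0r addr0 scale1r].
have EE z : E false z -> E true z -> False.
  move=> z0 z1; have [+ _] := sE; move/seteqP => [/(_ z) + _]; apply.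
  by split => //; exact: subset_closure.
have [|/(_ _ f0)|/(_ _ f1)] := connected_subset sE fA.
- apply: connected_continuous_connected; first exact: segment_connected.
  exact: continuous_subspaceT.
- by move/EE; apply.
- by move=> Ex1; apply: (EE x).
Qed.

Section DisjointUnions.
Variables (R : realType) (d : nat).
Implicit Types A B K P Q X Y : set 'rV[R]_d.

Lemma convex_sub_setU K A B : convex_set (M := 'rV[R]_d) K ->
  closed A -> closed B -> A `&` B = set0 -> K `<=` A `|` B ->
  K `<=` A \/ K `<=` B.
Proof.
move=> /convex_connected cK clA clB AB KAB.
exact: connected_subset (closed_disjoint_separated clA clB AB) KAB cK.
Qed.

(** Each convex part of [Y] lies entirely in [P] or in [Q]. As neither of these is empty, [P] and
    [Q] are the two convex parts in some order. *)
Lemma disjoint_union_of_two_convex_split Y P Q :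
  disjoint_union_of_two_convex Y -> closed P -> closed Q ->
  P !=set0 -> Q !=set0 -> P `&` Q = set0 -> Y = P `|` Q ->
  convex_set (M := 'rV[R]_d) P /\ convex_set (M := 'rV[R]_d) Q.
Proof.
move=> [A [B [[A0 clA cA] [B0 clB cB] AB YAB]]] clP clQ [p Pp] [q Qq] PQ YPQ.
have PQF x : P x -> Q x -> False.
  by move=> Px Qx; move/seteqP : PQ => [/(_ x) + _]; apply.
have AY : A `<=` P `|` Q by rewrite -YPQ YAB; exact: subsetUl.
have BY : B `<=` P `|` Q by rewrite -YPQ YAB; exact: subsetUr.
have PY x : P x -> A x \/ B x.
  by move=> Px; rewrite -[_ \/ _]/((A `|` B) x) -YAB YPQ; left.
have QY x : Q x -> A x \/ B x.
  by move=> Qx; rewrite -[_ \/ _]/((A `|` B) x) -YAB YPQ; right.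
have [AP|AQ] := convex_sub_setU cA clP clQ PQ AY;
  have [BP|BQ] := convex_sub_setU cB clP clQ PQ BY.
- by exfalso; case: (QY q Qq) => [/AP|/BP] /PQF; apply.
- have -> : P = A.
    by apply/seteqP; split => // x Px; case: (PY x Px) => // /BQ /(PQF x Px).
  have -> : Q = B.
    by apply/seteqP; split => // x Qx; case: (QY x Qx) => // /AP /PQF /(_ Qx).
  by [].
- have -> : P = B.
    by apply/seteqP; split => // x Px; case: (PY x Px) => // /AQ /(PQF x Px).
  have -> : Q = A.
    by apply/seteqP; split => // x Qx; case: (QY x Qx) => // /BP /PQF /(_ Qx).
  by [].
- by exfalso; case: (PY p Pp) => [/AQ|/BQ] /(PQF p Pp).
Qed.

Lemma disjoint_union_of_two_convexN Y :
  disjoint_union_of_two_convex Y -> ~ convex_set (M := 'rV[R]_d) Y.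
Proof.
move=> [A [B [[[a Aa] clA _] [[b Bb] clB _] AB YAB]]] cY.
have ABF x : A x -> B x -> False.
  by move=> Ax Bx; move/seteqP : AB => [/(_ x) + _]; apply.
have [YA|YB] : Y `<=` A \/ Y `<=` B.
  by apply: convex_sub_setU => //; rewrite YAB.
- by apply: (ABF b) => //; apply: YA; rewrite YAB; right.
- by apply: (ABF a) => //; apply: YB; rewrite YAB; left.
Qed.

Lemma two_convex_components_of_disjoint_union Y :
  disjoint_union_of_two_convex Y -> two_convex_components Y.
Proof.
move=> [A [B [[[a Aa] clA cA] [[b Bb] clB cB] AB YAB]]].
have ABF x : A x -> B x -> False.
  by move=> Ax Bx; move/seteqP : AB => [/(_ x) + _]; apply.
have comp P Q x : convex_set (M := 'rV[R]_d) P -> closed P -> closed Q ->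
    P `&` Q = set0 -> Y = P `|` Q -> P x -> connected_component Y x = P.
  move=> cP clP clQ PQ YPQ Px; apply/seteqP; split; last first.
    apply: connected_component_max => //; first by rewrite YPQ; exact: subsetUl.
    exact: convex_connected.
  have [//|CQ] : connected_component Y x `<=` P \/ connected_component Y x `<=` Q.
    apply: (connected_subset (closed_disjoint_separated clP clQ PQ)).
      by rewrite -YPQ; exact: connected_component_sub.
    exact: component_connected.
  exfalso; move/seteqP : PQ => [/(_ x) + _]; apply; split => //.
  by apply: CQ; apply: connected_component_refl; rewrite YPQ; left.
have compA x : A x -> connected_component Y x = A by exact: (comp _ B).
have compB x : B x -> connected_component Y x = B.
  by apply: (comp _ A) => //; [rewrite setIC|rewrite setUC].
have YE : components Y = [set A; B].
  apply/seteqP; split => [_ [x Yx <-]|C].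
    have [/compA ->|/compB ->] : (A `|` B) x by rewrite -YAB.
      by left.
    by right.
  case=> ->; [exists a; last exact: compA | exists b; last exact: compB].
  - by rewrite YAB; left.
  - by rewrite YAB; right.
split; last first.
  rewrite YE => C [] ->; split => //; first by exists a.
  by exists b.
(* Cardinality 2 is obtained by removing [A] and leaving a singleton; this needs [A] and [B]
   distinct, which [b] witnesses. *)
rewrite YE; apply/eq_cardSP; exists A; first by left.
have -> : [set A; B] `\ A = [set B].
  apply/seteqP; split => [C [[CA|//] nCA]|_ ->]; first by case: nCA.
  split; first by right.
  by move=> /= BA; apply: (ABF a) => //; rewrite BA.
exact: card_set1.
Qed.

End DisjointUnions.

(** * Domination in a finite indexed family of two-part sets *)

Section TwoPartFamilies.
Variables (R : realType) (d : nat) (T : finType).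
Variable C : T -> bool -> set 'rV[R]_d.

Let X j := C j true `|` C j false.
Let cap (J : {set T}) := \bigcap_(j in [set` J]) X j.

Hypothesis d2 : (2 <= d)%N.
Hypothesis CP : forall j b, nonempty_closed_convex (C j b).
Hypothesis Cdisj : forall j, C j true `&` C j false = set0.
Hypothesis capP : forall J : {set T}, (0 < #|J| <= d.+1)%N ->
  disjoint_union_of_two_convex (cap J).

Let Ccl j b : closed (C j b). Proof. by have [] := CP j b. Qed.
Let Ccv j b : convex_set (M := 'rV[R]_d) (C j b). Proof. by have [] := CP j b. Qed.

Let CF j b c x : C j b x -> C j c x -> b = c.
Proof.
have F : C j true x -> C j false x -> False.
  by move=> x1 x0; move/seteqP : (Cdisj j) => [/(_ x) + _]; apply.
by case: b c => [] [] // x1 x2; case: F.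
Qed.

Let XE j b : X j = C j b `|` C j (~~ b).
Proof. by case: b => //; rewrite setUC. Qed.

Let XC j b x : C j b x -> X j x.
Proof. by rewrite (XE j b); left. Qed.

Let capI (J : {set T}) x i : cap J x -> i \in J -> X i x.
Proof. by move=> Jx iJ; apply: Jx. Qed.

Let cap2 i j : cap [set i; j]%SET = X i `&` X j.
Proof.
apply/seteqP; split => [x Jx|x [xi xj] k /=].
  by split; apply: (capI Jx); rewrite !inE eqxx ?orbT.
by rewrite !inE => /orP[] /eqP ->.
Qed.

(** The indices may coincide, so this bound also serves pairs. *)
Let card3 (i j k : T) : (0 < #|[set i; j; k]%SET| <= d.+1)%N.
Proof.
apply/andP; split; first by apply/card_gt0P; exists i; rewrite !inE eqxx.
apply: leq_trans (leq_of_leqif (leq_card_setU _ _)) _.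
by rewrite cards1 addn1 cards2 ltnS (leq_trans _ d2) //; case: (i != j).
Qed.

Let cap2P i j : disjoint_union_of_two_convex (cap [set i; j]%SET).
Proof. by have := capP (card3 i i j); rewrite finset.setUid. Qed.

Let convex_sub_part K j : convex_set (M := 'rV[R]_d) K -> K `<=` X j ->
  exists b, K `<=` C j b.
Proof.
move=> cK KX.
have [K1|K0] := convex_sub_setU cK (@Ccl j true) (@Ccl j false) (Cdisj j) KX.
  by exists true.
by exists false.
Qed.

(** This is the relation that [i] dominates [j]. *)
Let meets_both i j := forall b, X j `&` C i b !=set0.

Let meets_both_refl i : meets_both i i.
Proof. by move=> b; have [[x ix] _ _] := CP i b; exists x; split => //; exact: XC ix. Qed.

(** Domination makes both traces of [X j] on the parts of [X i] nonempty, so they split [X i] meet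
    [X j] into two disjoint closed pieces, which must be its convex parts. *)
Let convex_part i j b : meets_both i j ->
  convex_set (M := 'rV[R]_d) (X j `&` C i b).
Proof.
move=> ij; have Xcl : closed (X j) by exact: closedU.
suff [] : convex_set (M := 'rV[R]_d) (X j `&` C i b) /\
  convex_set (M := 'rV[R]_d) (X j `&` C i (~~ b)) by [].
apply: (disjoint_union_of_two_convex_split (cap2P i j)).
- exact: closedI.
- exact: closedI.
- exact: ij.
- exact: ij.
- by rewrite -subset0 => x [[_ /CF xb] [_ /xb]]; case: (b).
- by rewrite cap2 setIC (XE i b) setIUr.
Qed.

(** If each set misses a part of the other, their intersection is that of the two remaining parts,
    hence convex. *)
Let meets_both_total i j : meets_both i j \/ meets_both j i.
Proof.
apply: contrapT => /not_orP[/existsNP[b ij] /existsNP[c ji]].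
have /disjoint_union_of_two_convexN := cap2P i j; apply.
suff -> : cap [set i; j]%SET = C i (~~ b) `&` C j (~~ c) by exact: convex_setI.
rewrite cap2; apply/seteqP; split => x [xi xj]; last first.
  by split; [exact: XC xi | exact: XC xj].
split.
  by move: (xi); rewrite (XE i b) => -[xib|//]; case: ij; exists x.
by move: (xj); rewrite (XE j c) => -[xjc|//]; case: ji; exists x.
Qed.

(** If [X k] misses [C i b], the triple intersection lies in [C i (~~ b)]. The trace of [X j] there
    is convex, so it stays in one part [C j c], and the triple intersection becomes convex. *)
Let meets_both_trans j i k : meets_both i j -> meets_both j k -> meets_both i k.
Proof.
move=> ij jk; apply: contrapT => /existsNP[b ik].
have [c Cc] : exists c, X j `&` C i (~~ b) `<=` C j c.
  by apply: convex_sub_part; [exact: convex_part | exact: subIsetl].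
have /disjoint_union_of_two_convexN := capP (card3 i j k); apply.
suff -> : cap [set i; j; k]%SET = (X j `&` C i (~~ b)) `&` (X k `&` C j c).
  by apply: convex_setI; exact: convex_part.
apply/seteqP; split => [x Jx|x [[xj xi] [xk xjc]] l /=].
  have [xi xj xk] : [/\ X i x, X j x & X k x].
    by split; apply: (capI Jx); rewrite !inE eqxx ?orbT.
  have xib : C i (~~ b) x.
    by move: xi; rewrite (XE i b) => -[xib|//]; case: ik; exists x.
  by do 2!split => //; apply: Cc.
by rewrite !inE => /orP[/orP[]|] /eqP -> //; exact: XC xi.
Qed.

(** Induction on the size of [J]: a maximal member of [J] without [i] is compared with [i]. *)
Let meets_both_max (J : {set T}) : (0 < #|J|)%N ->
  exists2 m, m \in J & forall j, j \in J -> meets_both m j.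
Proof.
have [n] := ubnP #|J|; elim: n J => // n IH J Jn /card_gt0P[i iJ].
have [J0|] := posnP #|(J :\ i)%SET|.
  exists i => // j jJ; have [->//|ji] := eqVneq j i.
  by move/eqP : J0; rewrite cards_eq0 => /eqP /setP /(_ j); rewrite !inE jJ ji.
case/IH => [|m]; first by move: Jn; rewrite (cardsD1 i) iJ ltnS.
rewrite !inE => /andP[mi mJ] mmax.
have [im|mi'] := meets_both_total i m.
  exists i => // j jJ; have [->//|ji] := eqVneq j i.
  by apply: (meets_both_trans im); apply: mmax; rewrite !inE ji.
exists m => // j jJ; have [->//|ji] := eqVneq j i.
by apply: mmax; rewrite !inE ji.
Qed.

(** Otherwise [cap J] would be the intersection of the convex traces on the other part of [X m]. *)
Let cap_meets_part (J : {set T}) m b : m \in J -> (#|J| <= d.+1)%N ->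
  (forall j, j \in J -> meets_both m j) -> cap J `&` C m b !=set0.
Proof.
move=> mJ Jd mmax; apply/set0P/negP => /eqP J0.
have : disjoint_union_of_two_convex (cap J).
  by apply: capP; rewrite Jd andbT; apply/card_gt0P; exists m.
move=> /disjoint_union_of_two_convexN; apply.
suff -> : cap J = \bigcap_(j in [set` J]) (X j `&` C m (~~ b)).
  by apply: convex_set_bigcap => j /= /mmax; exact: convex_part.
apply/seteqP; split => x Jx j jJ; last by case: (Jx j jJ).
split; first exact: Jx.
have : X m x by apply: Jx.
rewrite (XE m b) => -[xb|//]; exfalso.
by move/seteqP : J0 => [/(_ x) + _]; apply.
Qed.

(* The members of [J] have a common point in the part [C k (f k)] of a maximal
   [k] in [J]; the triple [m, k, j] shows that this point lies in [C j (f j)]. *)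
Let branch m b (f : T -> bool) : (forall j, meets_both m j) ->
  (forall j, X j `&` C m b `<=` C j (f j)) ->
  (\bigcap_j C j (f j)) !=set0.
Proof.
move=> mmax mf; apply: helly => // J Jd.
have [J0|/meets_both_max[k kJ kmax]] := posnP #|J|.
  by exists 0 => j /=; move/eqP : J0; rewrite cards_eq0 => /eqP ->; rewrite inE.
have [x [Jx xk]] := cap_meets_part (f k) kJ Jd kmax.
exists x => j /= jJ.
have [c Cc] : exists c, X j `&` C k (f k) `<=` C j c.
  by apply: convex_sub_part; [exact: convex_part (kmax j jJ) | exact: subIsetl].
suff -> : f j = c by apply: Cc; split => //; exact: Jx.
(* The point [y] lies in [C j (f j)] and in [C k (f k)], hence also in [C j c]; disjointness of the
   parts gives [f j = c]. *)
have [|||y [Jy ym]] := @cap_meets_part [set m; k; j]%SET m b.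
- by rewrite !inE eqxx.
- by have /andP[] := card3 m k j.
- by [].
have [yk yj] : X k y /\ X j y.
  by split; apply: (capI Jy); rewrite !inE eqxx ?orbT.
apply: (@CF j _ _ y); first exact: mf.
by apply: Cc; split => //; exact: mf.
Qed.

Lemma two_part_family_bigcap : (0 < #|T|)%N ->
  disjoint_union_of_two_convex (\bigcap_j (C j true `|` C j false)).
Proof.
move=> T0; have [m _ mmax] : exists2 m, m \in [set: T]%SET &
    forall j, j \in [set: T]%SET -> meets_both m j.
  by apply: meets_both_max; rewrite cardsT.
have {}mmax j : meets_both m j by apply: mmax; rewrite inE.
have [f fP] : exists f : bool -> T -> bool,
    forall b j, X j `&` C m b `<=` C j (f b j).
  suff /choice[f fP] : forall b, exists g : T -> bool,
    forall j, X j `&` C m b `<=` C j (g j) by exists f.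
  move=> b; have /choice[g gP] // : forall j, exists c, X j `&` C m b `<=` C j c.
    move=> j; apply: convex_sub_part; last exact: subIsetl.
    exact: convex_part.
  by exists g.
(* At [m] itself the two selections pick opposite parts, which makes the two final intersections
   disjoint. *)
have fm b : f b m = b.
  have [x [mx xb]] := meets_both_refl m b.
  by apply: (CF _ xb); exact: fP.
exists (\bigcap_j C j (f true j)), (\bigcap_j C j (f false j)); split.
- by split; [exact: branch (fP true) | exact: closed_bigI | exact: convex_set_bigcap].
- by split; [exact: branch (fP false) | exact: closed_bigI | exact: convex_set_bigcap].
- rewrite -subset0 => x [/(_ m I) + /(_ m I)]; rewrite !fm => x1 x0.
  by have := CF x1 x0.
- apply/seteqP; split => [x Xx|x [] Cx j _]; last 2 first.
  - exact: XC (Cx j I).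
  - exact: XC (Cx j I).
  have [xm|xm] : X m x by exact: Xx.
    by left => j _; apply: fP; split => //; exact: Xx.
  by right => j _; apply: fP; split => //; exact: Xx.
Qed.

End TwoPartFamilies.

(** * From indexed families to finite sets of sets *)

Lemma card_eq_finset (T : finType) (J : {set T}) : [set` J] #= `I_#|J|.
Proof.
have -> : [set` J] = range (enum_val : 'I_#|J| -> T).
  apply/seteqP; split => [j jJ|_ [i _ <-]]; last exact: enum_valP.
  by exists (enum_rank_in jJ j); rewrite ?enum_rankK_in.
apply: (card_eq_trans (inj_card_eq _)); first by move=> i j _ _; exact: enum_val_inj.
by rewrite card_eq_sym card_II.
Qed.

Theorem corollary4p3 (R : realType) (d : nat) (hd : (2 <= d)%N)
    (F : set (set 'rV[R]_d)) (Ffin : finite_set F) (Fne : F !=set0)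
    (hF1 : forall X, F X -> disjoint_union_of_two_convex X)
    (hFk : forall k : nat, (2 <= k <= d + 1)%N ->
       forall G : set (set 'rV[R]_d), G `<=` F -> G #= `I_k ->
         disjoint_union_of_two_convex (\bigcap_(X in G) X)) :
  two_convex_components (\bigcap_(X in F) X) /\
  (\bigcap_(X in F) X) !=set0.
Proof.
suff FP : disjoint_union_of_two_convex (\bigcap_(X in F) X).
  split; first exact: two_convex_components_of_disjoint_union.
  by case: FP => A [B [[[a Aa] _ _] _ _ ->]]; exists a; left.
have [S FS] := (@finite_fsetP _ F).1 Ffin.
have SF (X : S) : F (val X) by rewrite FS; exact: valP.
have /choice[C CP] : forall X : S, exists C : bool -> set 'rV[R]_d,
    [/\ forall b, nonempty_closed_convex (C b), C true `&` C false = set0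
      & val X = C true `|` C false].
  move=> X; have [A [B [AP BP AB XE]]] := hF1 _ (SF X).
  by exists (fun b => if b then A else B); split => // -[].
have CX X : C X true `|` C X false = val X by have [_ _] := CP X.
have -> : \bigcap_(X in F) X = \bigcap_(X : S) (C X true `|` C X false).
  apply/seteqP; split => [x Fx X _|x Sx X]; first by rewrite CX; exact: Fx.
  by rewrite FS => /= XS; have := Sx [` XS]%fset I; rewrite CX.
apply: two_part_family_bigcap => //.
- by move=> X b; have [] := CP X.
- by move=> X; have [] := CP X.
- move=> J /andP[J0 Jd].
  under eq_bigcapr do rewrite CX.
  (* [hFk] starts at [k = 2], so singletons are handled by [hF1]. *)
  have [/cards1P[X ->]|J1] := boolP (#|J| == 1%N).
    have -> : [set` [set X]%SET] = [set X].
      by apply/seteqP; split => Y /=; rewrite inE => /eqP.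
    by rewrite bigcap_set1; apply: hF1.
  rewrite -(bigcap_image [set` J] val id); apply: (hFk #|J|).
  + by rewrite addn1 Jd andbT ltn_neqAle eq_sym J1.
  + by move=> _ [X _ <-].
  + apply: card_eq_trans (card_eq_finset J); apply: inj_card_eq.
    by move=> X Y _ _; exact: val_inj.
- have [X] := Fne; rewrite FS => /= XS.
  by apply/card_gt0P; exists [` XS]%fset.
Qed.
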